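(* Let $K,L,T$ be positive integers with $2KL-K-L-\min\{K,L\}+3\le T$. Then every normal degree table $(\alpha^*,\beta^* )\in\mathcal{A}(K,L,T)$ with $\operatorname{N}(\alpha^*,\beta^* )=\operatorname{N}(K,L,T)$ has largest entry of $\alpha^*$ at most $2KL+T-1-L$ and largest entry of $\beta^*$ at most $2KL+T-1-K$.
   Context: A degree table with parameters $K,L,T$ is a tuple $(\alpha_{\mathrm p},\alpha_{\mathrm s},\beta_{\mathrm p},\beta_{\mathrm s})$ of nonnegative integer vectors of lengths $K,T,L,T$ such that, with $\alpha=(\alpha_{\mathrm p}\mid\alpha_{\mathrm s})$, $\beta=(\beta_{\mathrm p}\mid\beta_{\mathrm s})$: (i) entries of $\alpha$ are distinct; (ii) entries of $\beta$ are distinct; (iii) for every integer $n\in\operatorname{Set}(\alpha_{\mathrm p})+\operatorname{Set}(\beta_{\mathrm p})$ there is a unique $i\in\operatorname{Set}(\alpha)$ and unique $j\in\operatorname{Set}(\beta)$ with $n=i+j$. $\operatorname{Set}(v)$ is the set of entries of $v$, $A+B=\{a+b\}$. $\mathcal{A}(K,L,T)$ is the set of degree tables, $\operatorname{N}(\alpha,\beta)=|\operatorname{Set}(\alpha)+\operatorname{Set}(\beta)|$, and $\operatorname{N}(K,L,T)=\min_{(\alpha,\beta)\in\mathcal{A}(K,L,T)}\operatorname{N}(\alpha,\beta)$. A degree table is normal if each of $\alpha_{\mathrm p},\alpha_{\mathrm s},\beta_{\mathrm p},\beta_{\mathrm s}$ is sorted in increasing order, the smallest entry of $\alpha$ is $0$,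 the smallest entry of $\beta$ is $0$, and the greatest common divisor of all entries of $\alpha_{\mathrm p},\alpha_{\mathrm s},\beta_{\mathrm p},\beta_{\mathrm s}$ is $1$. *)

(* Defs.v *)
From mathcomp Require Import all_boot.
Set Implicit Arguments. Unset Strict Implicit. Unset Printing Implicit Defensive.

Definition Set_of (v : seq nat) : seq nat := undup v.

Definition sumset (A B : seq nat) : seq nat :=
  undup [seq a + b | a <- A, b <- B].

Definition degree_table (K L T : nat) (ap as_ bp bs : seq nat) : Prop :=
  [/\ size ap = K, size as_ = T, size bp = L & size bs = T] /\
  uniq (ap ++ as_) /\
  uniq (bp ++ bs) /\
  (
      forall n, n \in sumset (Set_of ap) (Set_of bp) ->
        count (fun ij : nat * nat => ij.1 + ij.2 == n)
          [seq (i, j) | i <- Set_of (ap ++ as_), j <- Set_of (bp ++ bs)] = 1 ).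

Definition Nab (ap as_ bp bs : seq nat) : nat :=
  size (sumset (Set_of (ap ++ as_)) (Set_of (bp ++ bs))).

(* N(alpha,beta) = N(K,L,T) := min over A(K,L,T): attains the minimum *)
Definition attains_N (K L T : nat) (ap as_ bp bs : seq nat) : Prop :=
  degree_table K L T ap as_ bp bs /\
  forall ap' as' bp' bs', degree_table K L T ap' as' bp' bs' ->
    Nab ap as_ bp bs <= Nab ap' as' bp' bs'.

Definition normal_table (ap as_ bp bs : seq nat) : Prop :=
  [/\ sorted ltn ap, sorted ltn as_, sorted ltn bp & sorted ltn bs] /\
  0 \in ap ++ as_ /\ 0 \in bp ++ bs /\
  foldr gcdn 0 (ap ++ as_ ++ bp ++ bs) = 1.

(* Main.v *)
(* Write k = |A|, l = |B| for the entry sets A, B of alpha, beta, and m = max A,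
   with max B <= m. The GASP_big table bounds the minimum by 2KL + 2T - 1, which
   under the hypothesis on T is at most k + l + min(k, l) - 4. A version of
   Freiman's 3k-4 theorem for two distinct sets, deduced from Kneser's theorem in
   Z/m, gives |A + B| >= l + m or |A + B| >= k + 2l - 3; only the former is
   possible, so m <= N - l. Hence A is dense enough in [0, m] for A + B to cover
   all residues modulo max B, and this gives max B <= N - k. *)
Require Import Defs.
From mathcomp Require Import all_boot all_fingroup finalg zmodp cyclic zify.
Set Implicit Arguments. Unset Strict Implicit. Unset Printing Implicit Defensive.

Local Open Scope group_scope.

(** * Kneser's theorem in finite abelian groups *)

Lemma memM_period (gT : finGroupType) (H : {group gT}) (C : {set gT}) x h :
  C * H \subset C -> h \in H -> (x * h \in C) = (x \in C).
Proof.
move=> CH Hh; apply/idP/idP=> Cx; last exact: subsetP CH _ (mem_mulg Cx Hh).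
by rewrite -(mulgK h x); apply: subsetP CH _ (mem_mulg Cx _); rewrite groupV.
Qed.

(** A product [p] has at most |H1 ∩ H2| factorizations: once a first factor [r p] is fixed, any
    other first factor [u] has [(r p)^-1 * u] in both groups. *)
Lemma leq_card_mulset (gT : finGroupType) (H1 H2 : {group gT}) (U V : {set gT}) :
  U \subset H1 -> V \subset H2 -> (#|U| * #|V| <= #|(U * V)%g| * #|H1 :&: H2|)%N.
Proof.
move=> /subsetP UH1 /subsetP VH2.
pose r p := odflt 1 [pick u in U | u^-1 * p \in V].
have rP p : p \in U * V -> r p \in U /\ (r p)^-1 * p \in V.
  case/mulsgP=> u v Uu Vv ->; rewrite /r; case: pickP => [w /andP[]//|].
  by move/(_ u); rewrite Uu mulKg Vv.
pose f (z : gT * gT) := (z.1 * z.2, (r (z.1 * z.2))^-1 * z.1).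
rewrite -!cardsX -(card_in_imset (f := f)); last first.
  move=> [u v] [u' v'] _ _ [/= e]; rewrite e => /mulgI e1.
  by move: e; rewrite e1 => /mulgI ->.
apply/subset_leq_card/subsetP=> _ /imsetP[[u v] /setXP[/= Uu Vv] ->].
have UVp := mem_mulg Uu Vv; have [Ur Vr] := rP _ UVp.
rewrite inE /= UVp inE groupM ?groupV ?UH1 //=.
have -> : (r (u * v))^-1 * u = (r (u * v))^-1 * (u * v) * v^-1.
  by rewrite !mulgA mulgK.
by rewrite groupM ?groupV ?VH2.
Qed.

(** If both alternatives fail, then P(Q-h) < h(p-h) and q(p-h) < h(Q-h), which is impossible when h
    is at most P and at most q. *)
Lemma grid_inequality (h m1 m2 P Q p q D1 D2 : nat) :
  (0 < h -> h <= P -> h <= Q -> h <= q -> P + p = m1 -> Q + q = m2 ->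
  P * Q <= D2 * h -> p * q <= D1 * h -> m1 <= D2 + h \/ m2 <= D1 + h)%N.
Proof.
move=> h0 hP hQ hq <- <- PQ pq.
case: (leqP (P + p) (D2 + h)) => [|l1]; first by left.
case: (leqP (Q + q) (D1 + h)) => [|l2]; first by right.
have e1 : (P * (Q - h) < h * (p - h))%N by nia.
have e2 : (q * (p - h) < h * (Q - h))%N by nia.
have : (h * (Q - h) <= P * (Q - h))%N by rewrite leq_mul2r hP orbT.
have : (h * (p - h) <= q * (p - h))%N by rewrite leq_mul2r hq orbT.
lia.
Qed.

Lemma period_diff (gT : finGroupType) (H1 H2 : {group gT}) (C1 C2 : {set gT}) x :
  (forall y z : gT, commute y z) ->
  C1 * H1 \subset C1 -> C2 * H2 \subset C2 -> x \in C2 :\: C1 ->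
  [\/ #|H1| <= #|C2 :\: C1| + #|H1 :&: H2|,
      #|H2| <= #|C1 :\: C2| + #|H1 :&: H2| | #|H2| <= #|C2 :\: C1| ].
Proof.
move=> mulC C1H C2H /setDP[xC2 xC1].
(* On the grid of points [x * u * v], with [u] in [H1] and [v] in [H2], membership in [C2] depends
   on [u] alone and membership in [C1] on [v] alone. So [U * V] gives points of [C2 :\: C1], and the
   two complements give points of [C1 :\: C2]. *)
pose U := [set h in H1 | x * h \in C2]; pose V := [set h in H2 | x * h \notin C1].
have sU : U \subset H1 by apply/subsetP=> h; rewrite inE => /andP[].
have sV : V \subset H2 by apply/subsetP=> h; rewrite inE => /andP[].
have le2 : (#|U * V| <= #|C2 :\: C1|).
  rewrite -(card_lcoset (U * V) x); apply/subset_leq_card/subsetP=> y.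
  rewrite mem_lcoset => /mulsgP[u v]; rewrite !inE => /andP[Hu Cu] /andP[Hv Cv] e.
  have {e}-> : y = x * u * v by rewrite -mulgA -e mulKVg.
  by rewrite (memM_period _ C2H) // Cu -mulgA (mulC u) mulgA (memM_period _ C1H) // Cv.
have le1 : (#|(H1 :\: U) * (H2 :\: V)| <= #|C1 :\: C2|).
  rewrite -(card_lcoset ((H1 :\: U) * (H2 :\: V)) x); apply/subset_leq_card/subsetP=> y.
  rewrite mem_lcoset => /mulsgP[u v]; rewrite !inE.
  case/andP=> + Hu; rewrite Hu /= => Cu /andP[+ Hv]; rewrite Hv /= negbK => Cv e.
  have {e}-> : y = x * u * v by rewrite -mulgA -e mulKVg.
  by rewrite (memM_period _ C2H) // Cu -mulgA (mulC u) mulgA (memM_period _ C1H) // Cv.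
have hU : (#|H1 :&: H2| <= #|U|).
  apply/subset_leq_card/subsetP=> h /setIP[h1 h2].
  by rewrite inE h1 (memM_period _ C2H).
have hV : (#|H1 :&: H2| <= #|V|).
  apply/subset_leq_card/subsetP=> h /setIP[h1 h2].
  by rewrite inE h2 (memM_period _ C1H).
have cU : (#|U| + #|H1 :\: U| = #|H1|).
  by rewrite -(cardsID U H1) (setIidPr sU).
have cV : (#|V| + #|H2 :\: V| = #|H2|).
  by rewrite -(cardsID V H2) (setIidPr sV).
(* If no [x * v] lies in [C1], the whole coset of [H2] at [x] lies in [C2 :\: C1]. *)
case: (set_0Vmem (H2 :\: V)) => [V0|[v]].
  constructor 3; move: cV; rewrite V0 cards0 addn0 => <-.
  apply: leq_trans le2; apply/subset_leq_card/subsetP=> v Vv.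
  by rewrite -(mul1g v) mem_mulg // inE group1 mulg1.
rewrite !inE => /andP[+ Hv]; rewrite Hv /= negbK => Cv.
have hV' : (#|H1 :&: H2| <= #|H2 :\: V|).
  rewrite -(card_lcoset (H1 :&: H2) v); apply/subset_leq_card/subsetP=> y.
  rewrite mem_lcoset => /setIP[h1 h2].
  rewrite -(mulKVg v y); move: (v^-1 * y) h1 h2 => h h1 h2.
  by rewrite !inE groupM //= negbK mulgA (memM_period _ C1H) // Cv.
have [] // := grid_inequality (D1 := #|C1 :\: C2|) (D2 := #|C2 :\: C1|)
   (cardG_gt0 (H1 :&: H2)) hU hV hV' cU cV; try by [constructor 1 | constructor 2].
- by apply: leq_trans (leq_card_mulset sU sV) _; rewrite leq_mul2r le2 orbT.
- apply: leq_trans (leq_card_mulset (subsetDl _ _) (subsetDl _ _)) _.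
  by rewrite leq_mul2r le1 orbT.
Qed.

(* Kemperman's lemma; [period_diff] is its one-sided half, read off from the
   (H1, H2)-grid on the coset of a point of [C2 :\: C1]. *)
Lemma period_union (gT : finGroupType) (H1 H2 : {group gT}) (C1 C2 : {set gT}) n :
  (forall y z : gT, commute y z) ->
  C1 * H1 \subset C1 -> C2 * H2 \subset C2 ->
  ~~ (C1 \subset C2) -> ~~ (C2 \subset C1) ->
  (n <= #|C1| + #|H1| -> n <= #|C2| + #|H2| ->
   n <= #|C1 :|: C2| + #|H1 :&: H2|).
Proof.
move=> mulC C1H C2H.
rewrite -setD_eq0 => /set0Pn[y yD]; rewrite -setD_eq0 => /set0Pn[x xD] n1 n2.
have := cardsUI C1 C2; have := cardsID C2 C1; have := cardsID C1 C2.
rewrite [C2 :&: C1]setIC => e2 e1 eU.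
have g0 := cardG_gt0 (H1 :&: H2).
have [a|a|a] := period_diff mulC C1H C2H xD; try by lia.
(* Only |H2| <= |C2 \ C1| is left. If the swapped statement also ends in its third case, averaging
   |C1| + |H2| and |C2| + |H1|, both at most |C1 ∪ C2|, gives [n]. *)
have := period_diff mulC C2H C1H yD; rewrite [H2 :&: H1]setIC.
by case=> b; lia.
Qed.

Lemma mul_gen_subset (gT : finGroupType) (W X : {set gT}) :
  W * X \subset W -> W * <<X>> \subset W.
Proof.
move=> WX; have [n ->] := gen_expgs X.
have W1 : W * (1 |: X) \subset W by rewrite mulgU mulg1 subUset subxx.
elim: n => [|n IHn]; first by rewrite expg0 mulg1.
by rewrite expgSr mulgA (subset_trans (mulSg _ IHn)).
Qed.

(* Induction on [B] with the Dyson transform (A, B) |-> (A :|: eB, B :&: e^-1 A). *)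
Lemma kneser_through (gT : finGroupType) (A B : {set gT}) a :
  (forall y z : gT, commute y z) -> 1 \in B -> a \in A ->
  exists (C : {set gT}) (H : {group gT}),
    [/\ a \in C, C \subset A * B, C * H \subset C &
        (#|A| + #|B| <= #|C| + #|H|)].
Proof.
move=> mulC; elim: {B}_.+1 {-2}B (ltnSn #|B|) A => // n IHn B leB A B1 Aa.
case: (boolP (A * B \subset A)) => [AB|].
  exists A, <<B>>%G; split=> //; last 2 first.
  - exact: mul_gen_subset.
  - by rewrite leq_add2l subset_leq_card ?subset_gen.
  by apply/subsetP=> y Ay; rewrite -(mulg1 y) mem_mulg.
case/subsetPn=> _ /mulsgP[e b Ae Bb ->] nA.
pose A1 := A :|: e *: B; pose B1' := B :&: e^-1 *: A.
have cB : (#|B1'| = #|A :&: e *: B|).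
  rewrite -(card_lcoset B1' e) /B1'; congr #|pred_of_set _|.
  apply/setP=> y; rewrite mem_lcoset !inE !mem_lcoset.
  by rewrite invgK mulKVg andbC.
(* The point [b] drops out because [e * b] is not in [A]; [1] stays because [e] is in [A]. *)
have ltB : (#|B1'| < #|B|).
  apply: proper_card; rewrite properEneq subsetIl andbT.
  apply/eqP=> /setP/(_ b); rewrite !inE mem_lcoset invgK Bb /=.
  by rewrite (negbTE nA).
have [] := IHn B1' _ A1; rewrite ?inE ?mem_lcoset ?invgK ?mulg1 ?B1 ?Ae ?Aa //.
  exact: leq_trans ltB leB.
move=> C [H [aC sC CH le]]; exists C, H; split=> //; last first.
  apply: leq_trans le; rewrite cB -(card_lcoset B e).
  by rewrite -(cardsUI A (e *: B)).
apply: subset_trans sC _; apply/subsetP=> x /mulsgP[y z].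
rewrite !inE !mem_lcoset invgK => yA /andP[zB zA] ->.
case/orP: yA => yA; first exact: mem_mulg.
have -> : y * z = (e * z) * (e^-1 * y) by rewrite (mulC e) -mulgA mulKVg (mulC z).
exact: mem_mulg.
Qed.

(** Among the periodic pieces of [A * B] that satisfy the bound, take a largest one. If it missed a
    point [c], its union with a piece through [c] would be a larger one by [period_union]. *)
Lemma kneser_weak (gT : finGroupType) (A B : {set gT}) :
  (forall y z : gT, commute y z) -> A != set0 -> B != set0 ->
  exists H : {group gT}, A * B * H \subset A * B /\
     (#|A| + #|B| <= #|A * B| + #|H|).
Proof.
move=> mulC /set0Pn[a0 Aa0] /set0Pn[b0 Bb0].
have through c : c \in A * B -> exists (C : {set gT}) (H : {group gT}),
    [/\ c \in C, C \subset A * B, C * H \subset C &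
        (#|A| + #|B| <= #|C| + #|H|)].
  case/mulsgP=> a b Aa Bb ->.
  (* Translating [B] by [b^-1] brings [1] into the second set. *)
  have [|C [H [aC sC CH le]]] := @kneser_through _ A (b^-1 *: B) a mulC _ Aa.
    by rewrite mem_lcoset invgK mulg1.
  have bC y : (y \in b *: C) = (y * b^-1 \in C) by rewrite mem_lcoset (mulC y).
  exists (b *: C), H; split; rewrite ?card_lcoset ?bC ?mulgK //.
  - apply/subsetP=> y; rewrite bC => /(subsetP sC)/mulsgP[u v Au].
    rewrite mem_lcoset invgK => Bv e; rewrite -(mulgKV b y) e -mulgA (mulC v).
    exact: mem_mulg.
  - apply/subsetP=> _ /mulsgP[u v Cu Hv ->].
    by rewrite bC -mulgA (mulC v) mulgA (memM_period _ CH) // -bC.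
  - by rewrite -(card_lcoset B b^-1).
pose good (p : {set gT} * {group gT}) :=
  [&& p.1 \subset A * B, p.1 * p.2 \subset p.1 & #|A| + #|B| <= #|p.1| + #|p.2|].
have [C0 [H0 [_ s0 p0 l0]]] := through _ (mem_mulg Aa0 Bb0).
have good0 : good (C0, H0) by apply/and3P.
case: (arg_maxnP (fun p : {set gT} * {group gT} => #|p.1|) good0).
case=> C H /and3P[/= sC CH le] maxC.
suff E : A * B \subset C.
  have -> : A * B = C by apply/eqP; rewrite eqEsubset E.
  by exists H.
apply: contraT => /subsetPn[c ABc nCc].
have [C' [H' [cC' s' p' l']]] := through _ ABc.
have nC'C : ~~ (C' \subset C) by apply/subsetPn; exists c.
have nCC' : ~~ (C \subset C').
  apply/negP=> CC'; have := maxC (C', H'); rewrite /good /= s' p' l' => /(_ isT).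
  move=> l; have := proper_card (A := C) (B := C').
  by rewrite properE CC' nC'C => /(_ isT); rewrite ltnNge l.
have := maxC (C :|: C', (H :&: H')%G); rewrite /good /= subUset sC s'.
rewrite (period_union mulC CH p') //= andbT => /(_ _) l.
have perU : (C :|: C') * (H :&: H') \subset C :|: C'.
  apply/subsetP=> _ /mulsgP[u v /setUP Cu /setIP[Hv H'v] ->]; rewrite inE.
  by rewrite (memM_period _ CH) // (memM_period _ p') //; apply/orP.
have := l perU; have := proper_card (A := C) (B := C :|: C').
by rewrite properE subsetUl subUset subxx (negbTE nC'C) /= => /(_ isT); rewrite ltnNge => /negP.
Qed.

(** Take [H] to be a largest period of [A * B] and apply the weak form to [A * H] and [B * H], whose
    product is again [A * B]: the period it returns is no larger than [H]. *)
Lemma kneser (gT : finGroupType) (A B : {set gT}) :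
  (forall y z : gT, commute y z) -> A != set0 -> B != set0 ->
  exists H : {group gT}, A * B * H \subset A * B /\
     (#|A * H| + #|B * H| <= #|A * B| + #|H|).
Proof.
move=> mulC A0 B0.
have per1 : A * B * 1%G \subset A * B by rewrite mulg1.
case: (arg_maxnP (P := fun H : {group gT} => A * B * H \subset A * B)
  (fun H : {group gT} => #|H|) per1) => H perH maxH.
have nz (X : {set gT}) : X != set0 -> X * H != set0.
  case/set0Pn=> x Xx; apply/set0Pn; exists x; exact: subsetP (mulG_subl _ _) _ Xx.
have [H' []] := kneser_weak mulC (nz _ A0) (nz _ B0).
have -> : A * H * (B * H) = A * B.
  have HB : H * B = B * H.
    apply/setP=> y; apply/mulsgP/mulsgP=> -[u v Hu Bv ->]; exists v u => //; exact: mulC.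
  rewrite mulgA -(mulgA A) HB !mulgA -mulgA mulGid.
  by apply/eqP; rewrite eqEsubset perH mulG_subl.
move=> perH' le; exists H; split=> //.
by apply: leq_trans le _; rewrite leq_add2l; apply: maxH.
Qed.

Local Close Scope group_scope.


(** * Sumsets of finite sets of integers *)

Lemma sumsetP (A B : seq nat) z :
  reflect (exists a b, [/\ a \in A, b \in B & z = a + b]) (z \in sumset A B).
Proof.
rewrite /sumset mem_undup; apply: (iffP allpairsP).
  by case=> -[a b] [/= Aa Bb ->]; exists a, b.
by case=> a [b [Aa Bb ->]]; exists (a, b).
Qed.

Lemma mem_sumset (A B : seq nat) a b : a \in A -> b \in B -> a + b \in sumset A B.
Proof. by move=> Aa Bb; apply/sumsetP; exists a, b. Qed.

Lemma sumset_uniq (A B : seq nat) : uniq (sumset A B).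
Proof. exact: undup_uniq. Qed.

Lemma size_sumsetC (A B : seq nat) : size (sumset A B) = size (sumset B A).
Proof.
apply/eqP; rewrite eqn_leq; apply/andP; split; apply: uniq_leq_size;
  rewrite ?sumset_uniq // => z /sumsetP[a [b [Aa Bb ->]]];
  by rewrite addnC mem_sumset.
Qed.

Lemma seq_max (s : seq nat) x : x \in s ->
  exists2 m, m \in s & forall y, y \in s -> y <= m.
Proof.
move=> sx; have [||m sm mP] := @ex_maxnP (mem s) (\max_(y <- s) y).
- by exists x.
- by move=> y sy; apply: leq_bigmax_seq.
- by exists m.
Qed.

Lemma seq_min (s : seq nat) x : x \in s ->
  exists2 m, m \in s & forall y, y \in s -> m <= y.
Proof.
by move=> sx; have [|m sm mP] := @ex_minnP (mem s); [exists x | exists m].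
Qed.

(** The sums A + min B, followed by max A + b for the other b in B, are all distinct. *)
Lemma size_sumset_geq (A B : seq nat) a b : uniq A -> uniq B ->
  a \in A -> b \in B -> size A + size B <= (size (sumset A B)).+1.
Proof.
move=> uA uB /seq_max[m Am mP] /seq_min[b0 Bb bP].
pose s := map (addn b0) A ++ map (addn m) (rem b0 B).
have us : uniq s.
  rewrite cat_uniq !map_inj_uniq ?uA ?rem_uniq //=; try exact: addnI.
  rewrite andbT; apply/hasPn=> _ /mapP[y yB ->]; apply/negP=> /mapP[z zA e].
  have zm := mP _ zA; move: yB; rewrite mem_rem_uniq // inE => /andP[/eqP yb yB].
  by have := bP _ yB; lia.
have sub : {subset s <= sumset A B}.
  move=> z; rewrite mem_cat => /orP[] /mapP[y yA ->].
    by rewrite addnC mem_sumset.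
  by rewrite mem_sumset // (mem_rem yA).
have le : size s <= size (sumset A B) := uniq_leq_size us sub.
have e : size s = size A + (size B).-1 by rewrite size_cat !size_map size_rem.
have : 0 < size B by case: (B) Bb.
lia.
Qed.

(** * Residues of integer sets in a finite group *)

Lemma mem_expg_gcd (gT : finGroupType) (H : {group gT}) (x : gT) m n :
  (x ^+ m \in H -> x ^+ n \in H -> x ^+ gcdn m n \in H)%g.
Proof.
case: (posnP m) => [-> _|m0 Hm Hn]; first by rewrite gcd0n.
case: (egcdnP n m0) => km kn e _.
have -> : (x ^+ gcdn m n = ((x ^+ n) ^+ kn)^-1 * (x ^+ m) ^+ km)%g.
  by rewrite -!expgM (mulnC m) e expgD (mulnC n) mulKg.
by apply: groupM; rewrite ?groupV; apply: groupX.
Qed.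

Lemma mem_expg_foldr_gcd (gT : finGroupType) (H : {group gT}) (x : gT) (A : seq nat) :
  (forall a, a \in A -> (x ^+ a)%g \in H) -> (x ^+ foldr gcdn 0 A)%g \in H.
Proof.
elim: A => [|a A IHA] HA /=; first by rewrite expg0 group1.
apply: mem_expg_gcd; first by rewrite HA ?mem_head.
by apply: IHA => b Ab; rewrite HA // inE Ab orbT.
Qed.

(** Reduction modulo m in multiplicative notation: for [x] of order m, [x ^+ n] stands for the class
    of n. *)
Definition residues (gT : finGroupType) (x : gT) (A : seq nat) : {set gT} :=
  [set g | g \in [seq (x ^+ n)%g | n <- A]].

Lemma residuesP (gT : finGroupType) (x g : gT) (A : seq nat) :
  reflect (exists2 n, n \in A & g = x ^+ n)%g (g \in residues x A).
Proof. by rewrite inE; apply: mapP. Qed.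

Lemma mem_residues (gT : finGroupType) (x : gT) (A : seq nat) n :
  n \in A -> (x ^+ n)%g \in residues x A.
Proof. by move=> An; apply/residuesP; exists n. Qed.

Lemma residues_sumset (gT : finGroupType) (x : gT) (A B : seq nat) :
  residues x (sumset A B) = (residues x A * residues x B)%g.
Proof.
apply/setP=> g; apply/residuesP/mulsgP.
  case=> _ /sumsetP[a [b [Aa Bb ->]]] ->.
  by exists (x ^+ a)%g (x ^+ b)%g; rewrite ?mem_residues // expgD.
case=> _ _ /residuesP[a Aa ->] /residuesP[b Bb ->] ->.
by exists (a + b); rewrite ?mem_sumset // expgD.
Qed.

Lemma card_residues_leq (gT : finGroupType) (x : gT) (A : seq nat) :
  #|residues x A| <= size A.
Proof.
by rewrite -(size_map (fun n => x ^+ n)%g A) cardsE card_size.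
Qed.

Lemma residues_filter (gT : finGroupType) (x : gT) (A : seq nat) (Q : {set gT}) :
  residues x [seq n <- A | (x ^+ n)%g \in Q] = residues x A :&: Q.
Proof.
apply/setP=> g; rewrite in_setI; apply/residuesP/andP.
  by case=> n; rewrite mem_filter => /andP[Qn An] ->; rewrite mem_residues.
by case=> /residuesP[n An ->] Qn; exists n; rewrite ?mem_filter ?Qn.
Qed.

Lemma card_residues (gT : finGroupType) (x : gT) (A : seq nat) :
  uniq A -> (forall n, n \in A -> n < #[x]%g) -> #|residues x A| = size A.
Proof.
move=> uA ltA; rewrite -(size_map (fun n => x ^+ n)%g A) cardsE.
apply/card_uniqP; rewrite map_inj_in_uniq // => m n Am An /eqP.
by rewrite eq_expg_mod_order !modn_small ?ltA // => /eqP.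
Qed.

(** In the closed interval up to the order of [x], only the two endpoints share a residue, so at
    most one element is lost. *)
Lemma card_residues_geq (gT : finGroupType) (x : gT) (A : seq nat) :
  uniq A -> (forall n, n \in A -> n <= #[x]%g) -> size A <= #|residues x A|.+1.
Proof.
move=> uA leA.
have lt n : n \in rem #[x]%g A -> n < #[x]%g.
  by rewrite mem_rem_uniq // inE ltn_neqAle => /andP[-> /leA].
have sizeA : size A <= (size (rem #[x]%g A)).+1.
  by case: (boolP (#[x]%g \in A)) => [/size_rem|/rem_id] ->; rewrite ?leqSpred.
apply: leq_trans sizeA _; rewrite ltnS -(card_residues (rem_uniq _ uA) lt).
apply/subset_leq_card/subsetP=> g /residuesP[n /mem_rem An ->].
exact: mem_residues.
Qed.

(* A residue met by [A + B] is met by a sum outside [m + B], since any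
   [m + b] can be replaced by the smaller sum [0 + b]. *)
Lemma sumset_lift (gT : finGroupType) (x : gT) (A B : seq nat) (m : nat)
    (Q : {set gT}) :
  0 < m -> (x ^+ m = 1)%g -> 0 \in A -> m \in A -> uniq B ->
  (forall b, b \in B -> (x ^+ b)%g \notin Q) ->
  #|residues x (sumset A B) :\: Q| + size B <=
    size [seq s <- sumset A B | (x ^+ s)%g \notin Q].
Proof.
move=> m0 xm A0 Am uB BQ; set S := sumset A B.
pose low := [seq s <- S | ((x ^+ s)%g \notin Q) && (s \notin map (addn m) B)].
have lowP s : s \in S -> exists t, [/\ t \in S, t \notin map (addn m) B & (x ^+ t = x ^+ s)%g].
  elim/ltn_ind: s => s IHs Ss.
  case: (boolP (s \in map (addn m) B)) => [/mapP[b Bb e]|]; last by exists s.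
  have Sb : b \in S by rewrite -[b]add0n mem_sumset.
  have [|t [St tB xt]] := IHs b _ Sb; first by rewrite e; lia.
  by exists t; split; rewrite // xt e expgD xm mul1g.
have le1 : #|residues x S :\: Q| <= size low.
  apply: leq_trans (card_residues_leq x low); apply/subset_leq_card/subsetP=> g.
  rewrite in_setD => /andP[+ /residuesP[s Ss e]]; rewrite e => sQ.
  have [t [St tB xt]] := lowP s Ss.
  by rewrite -xt mem_residues // mem_filter xt sQ tB.
apply: leq_trans (_ : size (low ++ map (addn m) B) <= _).
  by rewrite size_cat size_map leq_add2r.
apply: uniq_leq_size.
  rewrite cat_uniq filter_uniq ?sumset_uniq // map_inj_uniq ?uB ?andbT //=;
    last exact: addnI.
  by apply/hasPn=> s sB; rewrite mem_filter sB /= andbF.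
move=> s; rewrite mem_cat !mem_filter => /orP[/andP[/andP[-> _]]//|].
by case/mapP=> b Bb ->; rewrite expgD xm mul1g BQ // mem_sumset.
Qed.

(** This is [sumset_lift] with nothing excluded: m residues, plus the |B| sums in m + B. *)
Lemma sumset_cover (gT : finGroupType) (x : gT) (A B : seq nat) m :
  0 < m -> #[x]%g = m -> #|gT| = m -> 0 \in A -> m \in A -> uniq B ->
  (residues x A * residues x B = [set: gT])%g ->
  size B + m <= size (sumset A B).
Proof.
move=> m0 ox cG A0 Am uB full.
have xm : (x ^+ m = 1)%g by rewrite -ox expg_order.
have := sumset_lift (Q := set0) m0 xm A0 Am uB.
rewrite residues_sumset full setD0 cardsT cG => lift.
rewrite addnC (leq_trans (lift _)) ?size_filter ?count_size //.
by move=> b _; rewrite inE.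
Qed.

(** * The Freiman-type dichotomy *)

(** Here [cR] counts residues of the sumset outside the coset Q, while [cQ] and [cN] count integer
    sums inside and outside Q. The loss of 3 is one for the collision of 0 with m in each of the two
    sets, and one from |A_i| + |B_j| - 1. *)
Lemma dichotomy_count (k l cA cB cAH cBH cAB h cR cAi cBj cSQ cQ cN cS : nat) :
  k <= cA.+1 -> l <= cB.+1 -> cAH + cBH <= cAB + h -> cR + l <= cN ->
  cR + h = cAB -> cA + h <= cAH + cAi -> cB + h <= cBH + cBj ->
  cAi + cBj <= cSQ.+1 -> cSQ <= cQ -> cS = cQ + cN -> k + 2 * l <= cS + 3.
Proof. lia. Qed.

(* Kneser's theorem modulo [m] gives a period [H] of [A + B]. Unless [B + H] is
   everything, some coset [i + j + H] of the sumset misses [B]; the integer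
   sums in that coset number at least [|A_i| + |B_j| - 1], and this makes up
   for the loss of [|H|] in Kneser's bound. *)
Lemma sumset_dichotomy (A B : seq nat) m :
  uniq A -> uniq B -> 0 \in A -> 0 \in B -> m \in A -> 0 < m ->
  (forall a, a \in A -> a <= m) -> (forall b, b \in B -> b <= m) ->
  foldr gcdn 0 A = 1 ->
  size B + m <= size (sumset A B) \/
  size A + 2 * size B <= size (sumset A B) + 3.
Proof.
case: m => // p uA uB A0 B0 Am m0 leA leB gcdA.
pose gT := 'I_p.+1 : finGroupType; pose x : gT := Zp1.
have ox : #[x]%g = p.+1 := order_Zp1 p.
have cG : #|gT| = p.+1 := card_ord p.+1.
have xm : (x ^+ p.+1 = 1)%g by rewrite -[in LHS]ox expg_order.
have mulC (y z : gT) : commute y z by apply: Zp_mulgC.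
set A' := residues x A; set B' := residues x B; set S := sumset A B.
have cA : size A <= #|A'|.+1 by apply: card_residues_geq; rewrite ?ox.
have cB : size B <= #|B'|.+1 by apply: card_residues_geq; rewrite ?ox.
have A'1 : 1%g \in A' by apply/residuesP; exists 0.
have B'1 : 1%g \in B' by apply/residuesP; exists 0.
have [|| H [perH leH]] := @kneser gT A' B' mulC; try by apply/set0Pn; exists 1%g.
(* If [B' * H] is stable under [A'], it is the whole group, since gcd 1 makes [A'] generate; as [H]
   is a period of [A' * B'], that product is full too. *)
case: (boolP (B' * H * A' \subset B' * H)%g) => [stabBH|].
  left; apply: (@sumset_cover gT x) => //; rewrite -/A' -/B'.
  have gx : x \in <<A'>>%g.
    rewrite -(expg1 x) -gcdA; apply: mem_expg_foldr_gcd => a Aa.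
    by rewrite mem_gen ?mem_residues.
  have BH g : g \in (B' * H)%g.
    apply: subsetP (mul_gen_subset stabBH) _ _; rewrite -[g]mul1g mem_mulg //.
      by rewrite -[1%g]mul1g mem_mulg.
    have : g \in [set: gT] by [].
    rewrite (Zp_cycle p); apply: subsetP; rewrite cycle_subG; exact: gx.
  apply/setP=> g; rewrite inE; apply: subsetP perH _ _.
  apply: subsetP _ _ (BH g); rewrite mulSg //; apply/subsetP=> y By.
  by rewrite -[y]mul1g mem_mulg.
case/subsetPn=> _ /mulsgP[_ i /mulsgP[j h Bj Hh ->] Ai ->] nBH; right.
have nji : (j * i \notin B' * H)%g.
  apply: contra nBH; rewrite -mulgA (mulC h) mulgA => ji.
  by rewrite -(mulGid H) mulgA mem_mulg.
pose Q := ((j * i)%g *: H)%g.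
have BQ b : b \in B -> (x ^+ b)%g \notin Q.
  move=> Bb; apply: contra nji; rewrite mem_lcoset => Hb.
  have -> : (j * i = x ^+ b * ((j * i)^-1 * x ^+ b)^-1)%g.
    by rewrite invMg invgK mulKVg.
  by rewrite mem_mulg ?groupV ?mem_residues.
have lift := sumset_lift m0 xm A0 Am uB BQ.
have QR : Q \subset residues x S.
  rewrite residues_sumset; apply: subset_trans perH.
  rewrite mulSg // sub1set (mulC j) mem_mulg //.
have cQ : #|residues x S :\: Q| + #|H| = #|(A' * B')%g|.
  by rewrite -residues_sumset -(cardsID Q (residues x S)) (setIidPr QR) card_lcoset addnC.
pose Ai' := [seq a <- A | (x ^+ a)%g \in (i *: H)%g].
pose Bj' := [seq b <- B | (x ^+ b)%g \in (j *: H)%g].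
(* Inclusion-exclusion for the residues of [X] and the coset of [g], both contained in the product
   of those residues with [H]. *)
have part (X : seq nat) g : g \in residues x X ->
  exists2 n, n \in [seq a <- X | (x ^+ a)%g \in (g *: H)%g] &
  #|residues x X| + #|H| <=
   #|(residues x X * H)%g| + size [seq a <- X | (x ^+ a)%g \in (g *: H)%g].
  case/residuesP=> n Xn ->; exists n; first by rewrite mem_filter mem_lcoset mulVg group1.
  rewrite -(card_lcoset H (x ^+ n)%g) -cardsUI leq_add //; last first.
    by rewrite -residues_filter card_residues_leq.
  rewrite subset_leq_card // subUset mulG_subl /= mulSg // sub1set.
  exact: mem_residues.
have [a Aa cAi] := part _ _ Ai; have [b Bb cBj] := part _ _ Bj.
have := size_sumset_geq (filter_uniq _ uA) (filter_uniq _ uB) Aa Bb.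
set SQ := sumset _ _ => leSQ.
have leQ : size SQ <= size [seq s <- S | (x ^+ s)%g \in Q].
  apply: uniq_leq_size; first exact: sumset_uniq.
  move=> _ /sumsetP[u [v [+ + ->]]]; rewrite !mem_filter !mem_lcoset.
  case/andP=> Hu Au /andP[Hv Bv]; rewrite mem_sumset // andbT expgD.
  rewrite invMg (mulC (x ^+ u)%g) -mulgA (mulgA j^-1%g) mulgA.
  by rewrite (mulC i^-1%g) -mulgA groupM.
have sizeS : size S = size [seq s <- S | (x ^+ s)%g \in Q] +
                size [seq s <- S | (x ^+ s)%g \notin Q].
  by rewrite !size_filter count_predC.
exact: dichotomy_count cA cB leH lift cQ cAi cBj leSQ leQ sizeS.
Qed.

(** * Bounds on the largest elements when the sumset is small *)

(** By pigeonhole, [X] meets the set of all [g * y^-1] with [y] in [Y]. *)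
Lemma mulset_full (gT : finGroupType) (X Y : {set gT}) :
  #|gT| < #|X| + #|Y| -> (X * Y = [set: gT])%g.
Proof.
move=> lt; apply/setP=> g; rewrite in_setT.
pose Z := [set (g * y^-1)%g | y in Y].
have cZ : #|Z| = #|Y|.
  by rewrite card_imset // => y z /mulgI /invg_inj.
case: (set_0Vmem (X :&: Z)) => [XZ0|[z /setIP[Xz /imsetP[y Yy e]]]].
  have := cardsUI X Z; rewrite XZ0 cards0 addn0 cZ => e.
  by move: lt; rewrite -e ltnNge max_card.
by apply/mulsgP; exists z y; rewrite // e mulgKV.
Qed.

(** At most a + 1 - m elements of A are m or more, and the rest are distinct modulo m; B loses at
    most one residue. The two residue sets then have total size above m, so they cover Z/m. *)
Lemma sumset_dense (A B : seq nat) a m :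
  uniq A -> uniq B -> 0 \in B -> m \in B -> 0 < m -> m <= a ->
  (forall x, x \in A -> x <= a) -> (forall x, x \in B -> x <= m) ->
  a + 2 < size A + size B -> size A + m <= size (sumset A B).
Proof.
case: m => // p uA uB B0 Bm m0 ma leA leB dense.
pose gT := 'I_p.+1 : finGroupType; pose x : gT := Zp1.
have ox : #[x]%g = p.+1 := order_Zp1 p.
have cG : #|gT| = p.+1 := card_ord p.+1.
rewrite size_sumsetC; apply: (@sumset_cover gT x) => //.
apply: mulset_full; rewrite cG.
have cB : size B <= #|residues x B|.+1 by apply: card_residues_geq; rewrite ?ox.
pose low := [seq y <- A | y < p.+1].
have cA : size low <= #|residues x A|.
  rewrite -(@card_residues gT x low) ?filter_uniq //; last first.
    by move=> y; rewrite mem_filter ox => /andP[].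
  apply/subset_leq_card/subsetP=> g /residuesP[y].
  by rewrite mem_filter => /andP[_ Ay] ->; rewrite mem_residues.
have cHigh : size [seq y <- A | ~~ (y < p.+1)] <= a.+1 - p.+1.
  rewrite -(size_iota p.+1 (a.+1 - p.+1)); apply: uniq_leq_size.
    exact: filter_uniq.
  by move=> y; rewrite mem_filter mem_iota => /andP[+ /leA]; lia.
have sizeA : size A = size low + size [seq y <- A | ~~ (y < p.+1)].
  by rewrite !size_filter count_predC.
move: cA cHigh sizeA cB ma dense; clear; lia.
Qed.

(** Adding A to the multiples of d in B and to the non-multiples gives disjoint sumsets. This
    excludes a common divisor of A alone when the sumset is small. *)
Lemma sumset_split (A B : seq nat) d b :
  uniq A -> uniq B -> 0 \in A -> 0 \in B -> (forall a, a \in A -> d %| a) ->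
  b \in B -> ~~ (d %| b) -> 2 * size A + size B <= size (sumset A B) + 2.
Proof.
move=> uA uB A0 B0 dA Bb db.
pose C := [seq y <- B | d %| y]; pose D := [seq y <- B | ~~ (d %| y)].
have C0 : 0 \in C by rewrite mem_filter dvdn0.
have Db : b \in D by rewrite mem_filter db.
have leC : size A + size C <= (size (sumset A C)).+1 :=
  size_sumset_geq uA (filter_uniq _ uB) A0 C0.
have leD : size A + size D <= (size (sumset A D)).+1 :=
  size_sumset_geq uA (filter_uniq _ uB) A0 Db.
have sizeB : size B = size C + size D by rewrite !size_filter count_predC.
have : size (sumset A C ++ sumset A D) <= size (sumset A B).
  apply: uniq_leq_size.
    rewrite cat_uniq !sumset_uniq andbT; apply/hasPn=> _ /sumsetP[y [z [Ay + ->]]].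
    rewrite mem_filter => /andP[dz _]; apply/negP=> /sumsetP[y' [z' [Ay' + e]]].
    rewrite mem_filter => /andP[dz' _]; case/negP: dz.
    by rewrite -(dvdn_addr _ (dA _ Ay)) e dvdn_add // dA.
  move=> s; rewrite mem_cat => /orP[] /sumsetP[y [z [Ay + ->]]];
    by rewrite mem_filter => /andP[_ Bz]; apply: mem_sumset.
rewrite size_cat; lia.
Qed.

Lemma dvdn_foldr_gcdn d (s : seq nat) :
  (d %| foldr gcdn 0 s) = all (dvdn d) s.
Proof. by elim: s => [|a s IHs] /=; rewrite ?dvdn0 // dvdn_gcd IHs. Qed.

Lemma small_sumset_bounds (A B : seq nat) m :
  uniq A -> uniq B -> 0 \in A -> 0 \in B -> m \in A ->
  (forall a, a \in A -> a <= m) -> (forall b, b \in B -> b <= m) ->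
  foldr gcdn 0 (A ++ B) = 1 ->
  size (sumset A B) + 4 <= size A + size B + minn (size A) (size B) ->
  (forall a, a \in A -> a + size B <= size (sumset A B)) /\
  (forall b, b \in B -> b + size A <= size (sumset A B)).
Proof.
move=> uA uB A0 B0 Am leA leB gcdAB small.
have m0 : 0 < m.
  rewrite lt0n; apply/eqP=> m0; suff : 0 %| 1 by [].
  rewrite -gcdAB dvdn_foldr_gcdn all_cat.
  by apply/andP; split; apply/allP=> y; [move/leA | move/leB]; rewrite m0; case: y.
have gcdA : foldr gcdn 0 A = 1.
  set d := foldr gcdn 0 A.
  have dA a : a \in A -> d %| a.
    by apply/allP; rewrite -dvdn_foldr_gcdn.
  case: (boolP (all (dvdn d) B)) => [dB|/allPn[b Bb db]].
    apply/eqP; rewrite -dvdn1 -gcdAB dvdn_foldr_gcdn all_cat dB andbT.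
    exact/allP.
  have := sumset_split uA uB A0 B0 dA Bb db; lia.
have leN : size B + m <= size (sumset A B).
  by case: (sumset_dichotomy uA uB A0 B0 Am m0 leA leB gcdA) => //; lia.
split=> [a /leA am|b Bb]; first by lia.
have [n Bn leBn] := seq_max B0.
(* If max B is 0 there is no modulus, and the trivial bound |A| + |B| - 1 suffices. *)
have := leBn _ Bb; case: (posnP n) => [n0 bn|n0 bn].
  have := size_sumset_geq uA uB A0 B0.
  have : 0 < size B by case: (B) B0.
  lia.
(* The density condition follows from m <= N - |B| and N <= |A| + 2|B| - 4. *)
have := sumset_dense uA uB B0 Bn n0 (leB _ Bn) leA leBn.
lia.
Qed.

(** * The GASP_big table and the bounds for degree tables *)

Lemma unique_sum_count (A B : seq nat) a b : uniq A -> uniq B ->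
  a \in A -> b \in B ->
  (forall a' b', a' \in A -> b' \in B -> a' + b' = a + b -> a' = a /\ b' = b) ->
  count (fun ij : nat * nat => ij.1 + ij.2 == a + b) [seq (i, j) | i <- A, j <- B] = 1.
Proof.
move=> uA uB Aa Bb unique.
have us : uniq [seq (i, j) | i <- A, j <- B].
  by apply: allpairs_uniq => // -[? ?] [? ?].
have sab : (a, b) \in [seq (i, j) | i <- A, j <- B].
  by apply/allpairsP; exists (a, b).
rewrite (@eq_in_count _ _ (pred1 (a, b))) ?count_uniq_mem ?sab //.
move=> _ /allpairsP[[i j] [/= Ai Bj ->]] /=.
rewrite xpair_eqE; apply/eqP/andP=> [/(unique _ _ Ai Bj)[-> ->] // | [/eqP-> /eqP->] //].
Qed.

(** Sums a + Kj of prefix entries are base-K expansions of numbers below KL, and every sum involving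
    a secret entry is at least KL. *)
Lemma gasp_big_degree_table K L T : 0 < K -> 0 < L ->
  degree_table K L T (iota 0 K) (iota (K * L) T)
    [seq K * j | j <- iota 0 L] (iota (K * L) T).
Proof.
move=> K0 L0; set ap := iota 0 K; set as_ := iota _ _; set bp := map _ _.
have ubp : uniq bp by rewrite map_inj_uniq ?iota_uniq // => i j; nia.
have apP a : a \in ap -> a < K by rewrite mem_iota.
have bpP b : b \in bp -> exists2 j, j < L & b = K * j.
  by case/mapP=> j; rewrite mem_iota => jL ->; exists j.
have asP a : a \in as_ -> K * L <= a by rewrite mem_iota => /andP[].
have ua : uniq (ap ++ as_).
  rewrite cat_uniq !iota_uniq andbT; apply/hasPn=> a /asP aKL.
  rewrite mem_iota; nia.
have ub : uniq (bp ++ as_).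
  rewrite cat_uniq ubp iota_uniq andbT; apply/hasPn=> b /asP bKL.
  by apply/negP=> /bpP[j jL e]; nia.
split; first by rewrite !size_iota size_map size_iota.
do 2!split=> //; move=> n; rewrite /Set_of !undup_id ?iota_uniq //.
case/sumsetP=> a [b [aap bbp ->]]; apply: unique_sum_count => //.
- by rewrite mem_cat aap.
- by rewrite mem_cat bbp.
have aK := apP _ aap; have [j jL ->] := bpP _ bbp.
have lt : a + K * j < K * L by nia.
move=> a' b'; rewrite !mem_cat => /orP[/apP a'K|/asP a'K]; last by move=> _; lia.
case/orP=> [/bpP[j' j'L ->] e|/asP b'K]; last by lia.
have [jj|jj|jj] := ltngtP j j'; [by nia | by nia | by rewrite jj in e *; lia].
Qed.

Lemma gasp_big_Nab K L T : 0 < K -> 0 < L -> 0 < T ->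
  Nab (iota 0 K) (iota (K * L) T) [seq K * j | j <- iota 0 L] (iota (K * L) T)
    <= 2 * K * L + 2 * T - 1.
Proof.
move=> K0 L0 T0; rewrite -(size_iota 0 (_ - 1)); apply: uniq_leq_size.
  exact: sumset_uniq.
move=> _ /sumsetP[a [b [+ + ->]]]; rewrite !mem_undup !mem_cat !mem_iota.
move=> aP bP; have {bP} : b < K * L + T.
  by case/orP: bP => [/mapP[j + ->]|/andP[]//]; rewrite mem_iota; nia.
have {aP} : a < K * L + T by case/orP: aP; nia.
lia.
Qed.

Theorem theorem7 (K L T : nat) (ap as_ bp bs : seq nat) :
  0 < K -> 0 < L -> 0 < T ->
  2 * K * L + 3 <= T + K + L + minn K L ->
  degree_table K L T ap as_ bp bs ->
  normal_table ap as_ bp bs ->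
  attains_N K L T ap as_ bp bs ->
  (forall a, a \in ap ++ as_ -> a + L <= 2 * K * L + T - 1) /\
  (forall b, b \in bp ++ bs -> b + K <= 2 * K * L + T - 1).
Proof.
move=> K0 L0 T0 hT [[sap sas sbp sbs] [uA [uB _]]] [_ [A0 [B0]]] + [_ minN].
have {minN} := leq_trans (minN _ _ _ _ (gasp_big_degree_table T K0 L0))
  (gasp_big_Nab K0 L0 T0).
rewrite /Nab /Set_of !undup_id // catA.
have : size (ap ++ as_) = K + T by rewrite size_cat sap sas.
have : size (bp ++ bs) = L + T by rewrite size_cat sbp sbs.
move: (ap ++ as_) (bp ++ bs) uA uB A0 B0 => A B uA uB A0 B0 sB sA leN gcdAB.
(* Adding 2T to the hypothesis bounds 2KL + 2T + 3 by (K+T) + (L+T) + min(K+T, L+T). *)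
have small : size (sumset A B) + 4 <= size A + size B + minn (size A) (size B).
  by rewrite sA sB; lia.
suff [bA bB] : (forall a, a \in A -> a + size B <= size (sumset A B)) /\
    (forall b, b \in B -> b + size A <= size (sumset A B)).
  by split=> [a /bA|b /bB]; rewrite ?sA ?sB; lia.
have [m Am leA] := seq_max A0; have [n Bn leB] := seq_max B0.
(* The pair of bounds is symmetric in A and B, so the set with the larger maximum can come first. *)
case: (leqP n m) => [nm|/ltnW mn].
  have leBm b : b \in B -> b <= m by move=> Bb; apply: leq_trans (leB _ Bb) nm.
  exact: small_sumset_bounds Am leA leBm gcdAB small.
have leAn a : a \in A -> a <= n by move=> Aa; apply: leq_trans (leA _ Aa) mn.
have gcdBA : foldr gcdn 0 (B ++ A) = 1.
  apply/eqP; rewrite -dvdn1 -gcdAB dvdn_foldr_gcdn all_cat andbC -all_cat.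
  by rewrite -dvdn_foldr_gcdn.
rewrite size_sumsetC minnC (addnC (size A)) in small; rewrite size_sumsetC.
by have [] := small_sumset_bounds uB uA B0 A0 Bn leB leAn gcdBA small.
Qed.
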